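(* Let $n \geq 5$ be an odd integer. Then Player $B$ has a winning strategy in the game $Z(n,d)$ for every integer $d \geq n+3$.
   Context: For integers $n \geq 4$ and $d \geq 2$, $Z(n,d)$ is the following two-player game. Initially the board contains the numbers $1,2,\dots,n$. Players $A$ and $B$ alternately cross out (remove) one number from the board, with $A$ moving first, until exactly two numbers remain. If the sum of the two remaining numbers is divisible by $d$, $A$ wins; otherwise $B$ wins. A player has a winning strategy if that player can force a win regardless of the opponent's moves. *)

(* Defs.v *)
From mathcomp Require Import all_boot.

Set Implicit Arguments.
Unset Strict Implicit.
Unset Printing Implicit Defensive.

Variant player := PlayerA | PlayerB.

(* A history lists the numbers crossed out so far, oldest move first. *)
Definition history := seq nat.

Definition board (n : nat) (h : history) : seq nat :=
  [seq x <- iota 1 n | x \notin h].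

Definition game_over (n : nat) (h : history) : bool := size (board n h) == 2.

Definition to_move (h : history) : player :=
  if odd (size h) then PlayerB else PlayerA.

Definition winner (n d : nat) (h : history) : player :=
  if d %| \sum_(x <- board n h) x then PlayerA else PlayerB.

Definition strategy := history -> nat.

(* [reachable n p s h]: h can arise in the n-number game when p follows s and
   the opponent makes arbitrary legal moves. The moves prescribed by s are not
   required to be legal here; this is imposed by [legal_strategy]. *)
Inductive reachable (n : nat) (p : player) (s : strategy) : history -> Prop :=
| reachable_start : reachable n p s [::]
| reachable_own (h : history) :
    reachable n p s h -> ~~ game_over n h -> to_move h = p ->
    reachable n p s (rcons h (s h))
| reachable_opponent (h : history) (x : nat) :
    reachable n p s h -> ~~ game_over n h -> to_move h <> p ->
    x \in board n h ->
    reachable n p s (rcons h x).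

Definition legal_strategy (n : nat) (p : player) (s : strategy) : Prop :=
  forall h : history, reachable n p s h -> ~~ game_over n h ->
    to_move h = p -> s h \in board n h.

Definition winning_strategy (n d : nat) (p : player) (s : strategy) : Prop :=
  legal_strategy n p s /\
  forall h : history, reachable n p s h -> game_over n h -> winner n d h = p.

Definition has_winning_strategy (n d : nat) (p : player) : Prop :=
  exists s : strategy, winning_strategy n d p s.

(* Main.v *)
(** Sums of two numbers on the board are less than [2 * d], so player A needs
    the last two numbers to form a pair [{x, d - x}]. As [d >= n + 3], there
    are at most [(n - 3) / 2] such pairs, which is the number of moves of
    player B, and B destroys one of them with each move. *)

Require Import Defs.
From mathcomp Require Import all_boot zify.

(* Each pair is represented by its smaller element. *)
Definition live_pairs (n d : nat) (h : history) : seq nat :=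
  [seq x <- board n h | (x < d - x) && (d - x \in board n h)].

(** Once no pair is left, any number on the board will do. The default [0] only occurs on an empty
    board. *)
Definition pair_breaker (n d : nat) : strategy :=
  fun h => head (head 0 (board n h)) (live_pairs n d h).

Lemma mem_board n h x : (x \in board n h) = (x \notin h) && (0 < x <= n).
Proof. by rewrite mem_filter mem_iota add1n ltnS. Qed.

Lemma board_uniq n h : uniq (board n h).
Proof. exact/filter_uniq/iota_uniq. Qed.

Lemma mem_board_rcons n h x y :
  (y \in board n (rcons h x)) = (y != x) && (y \in board n h).
Proof. by rewrite !mem_board mem_rcons inE negb_or -andbA. Qed.

Lemma board_rcons n h x : board n (rcons h x) = rem x (board n h).
Proof.
rewrite rem_filter ?board_uniq // -filter_predI; apply: eq_filter => y /=.
by rewrite mem_rcons inE negb_or.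
Qed.

Lemma size_board_rcons n h x :
  x \in board n h -> size (board n (rcons h x)) = (size (board n h)).-1.
Proof. by move=> xb; rewrite board_rcons size_rem. Qed.

Lemma mem_live_pairs n d h x :
  (x \in live_pairs n d h) =
  [&& x < d - x, d - x \in board n h & x \in board n h].
Proof. by rewrite mem_filter andbA. Qed.

Lemma live_pairs_uniq n d h : uniq (live_pairs n d h).
Proof. exact/filter_uniq/board_uniq. Qed.

Lemma sub_live_pairs_rcons n d h x :
  {subset live_pairs n d (rcons h x) <= [seq y <- live_pairs n d h | y != x]}.
Proof.
move=> y; rewrite mem_filter !mem_live_pairs !mem_board_rcons.
by case/and3P=> -> /andP[_ ->] /andP[-> ->].
Qed.

(** Crossing out the larger element of a pair destroys it too; the bound can ignore this, as B aims
    at smaller elements. *)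
Lemma size_live_pairs_rcons n d h x :
  size (live_pairs n d (rcons h x)) <=
  size (live_pairs n d h) - (x \in live_pairs n d h).
Proof.
apply: leq_trans (uniq_leq_size (live_pairs_uniq _ _ _)
                                (@sub_live_pairs_rcons n d h x)) _.
rewrite -rem_filter ?live_pairs_uniq //.
have [xP | xP] := boolP (x \in live_pairs n d h).
  by rewrite size_rem // subn1.
by rewrite rem_id // subn0.
Qed.

Lemma size_live_pairs_start n d :
  n + 3 <= d -> size (live_pairs n d [::]) <= (n - 2)./2.
Proof.
(* A smaller element [x] has [d - x <= n] and [2 * x < d], so it lies between [d - n] and
   [d.+1./2 - 1]. *)
move=> hd; apply: (@leq_trans (size (iota (d - n) (d.+1./2 - (d - n))))).
  apply: uniq_leq_size (live_pairs_uniq _ _ _) _ => x.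
  by rewrite mem_live_pairs !mem_board mem_iota /=; lia.
rewrite size_iota; lia.
Qed.

Lemma pair_breaker_live n d h :
  0 < size (live_pairs n d h) -> pair_breaker n d h \in live_pairs n d h.
Proof.
by rewrite /pair_breaker; case: live_pairs => //= x s; rewrite mem_head.
Qed.

Lemma pair_breaker_board n d h :
  0 < size (board n h) -> pair_breaker n d h \in board n h.
Proof.
move=> hb; have [/size0nil P0 | hP] := posnP (size (live_pairs n d h)).
  by rewrite /pair_breaker P0; case: (board n h) hb => //= x s; rewrite mem_head.
by have := pair_breaker_live _ _ _ hP; rewrite mem_live_pairs => /and3P[].
Qed.

Lemma winnerB_of_no_live_pair n d h :
  n < d -> game_over n h -> live_pairs n d h = [::] -> winner n d h = PlayerB.
Proof.
move=> hnd /eqP; rewrite /winner.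
case Eb: (board n h) (board_uniq n h) => [|a [|b []]] //= + _ P0.
rewrite inE andbT !big_cons big_nil addn0 => ab.
have [ha hb]: a \in board n h /\ b \in board n h by rewrite Eb !inE !eqxx orbT.
have noP x : (x \in live_pairs n d h) = false by rewrite P0.
case: ifP => // /dvdnP[q Eq].
move: (ha) (hb); rewrite !mem_board => /and3P[_ a0 an] /and3P[_ b0 bn].
have {Eq} sumd : a + b = d by case: q Eq => [|[|q]]; rewrite ?mulSn; lia.
have Eda : d - a = b by lia.
have Edb : d - b = a by lia.
(* As [a] and [b] are distinct, the smaller one would represent a live pair. *)
have:= noP a; have:= noP b.
by rewrite !mem_live_pairs Eda Edb ha hb !andbT; lia.
Qed.

(** For odd [n] the last move is A's, so [(size (board n h) - 2)./2] is exactly the number of moves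
    B has left. The first equation ties the parity of the board to the player whose turn it is. *)
Lemma pair_breaker_invariant n d h :
    odd n -> 5 <= n -> n + 3 <= d -> reachable n PlayerB (pair_breaker n d) h ->
  [/\ size (board n h) + size h = n, 2 <= size (board n h)
    & size (live_pairs n d h) <= (size (board n h) - 2)./2].
Proof.
move=> nodd hn hd; elim=> {h} [|h _ [Es b2 le_live]|h x _ [Es b2 le_live]].
- have -> : board n [::] = iota 1 n by apply/all_filterP/allP.
  by rewrite size_iota addn0; split=> //; [lia | exact: size_live_pairs_start].
- rewrite /game_over => not_over _.
  have hs : pair_breaker n d h \in board n h by apply: pair_breaker_board; lia.
  have := size_live_pairs_rcons n d h (pair_breaker n d h).
  rewrite size_board_rcons // size_rcons.
  (* B's move lowers the bound by one: either no pair was left anyway, or one is destroyed. *)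
  have [P0 | /pair_breaker_live ->] := posnP (size (live_pairs n d h)).
    by split; lia.
  by split; lia.
- rewrite /game_over => not_over + xb.
  have := size_live_pairs_rcons n d h x.
  rewrite size_board_rcons // size_rcons /to_move => le_rcons.
  (* The board is odd when A moves, so the bound does not drop. *)
  case: ifP => // h_even _; split; lia.
Qed.

Theorem theorem3p2p3 (n : nat) (hn : 5 <= n) (hodd : odd n)
    (d : nat) (hd : n + 3 <= d) :
  has_winning_strategy n d PlayerB.
Proof.
exists (pair_breaker n d); split=> h /pair_breaker_invariant[]// _ b2 le_live.
  by move=> _ _; apply: pair_breaker_board; lia.
move=> over; apply: winnerB_of_no_live_pair => //; first lia.
by apply/size0nil; move: over le_live; rewrite /game_over => /eqP->; lia.
Qed.
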